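(* Let $F$ be a field and let $f\colon A\to B$, where $A=\bigoplus_{g\in G}A^{(g)}$, be a morphism in $\mathbf{GrAlg}_F$ (respectively, in $\mathbf{GrAlg}^1_F$). Then $f$ is a monomorphism in that category if and only if for all $a,b\in\bigcup_{g\in G}A^{(g)}$ with $a\neq b$ one has $f(a)\neq f(b)$. In particular, each monomorphism in $\mathbf{GrAlg}_F$ and in $\mathbf{GrAlg}^1_F$ is graded injective.
   Context: Algebras are associative over the field $F$, not necessarily unital or commutative. A grading on an algebra $A$ by a group $G$ is a decomposition $A=\bigoplus_{g\in G}A^{(g)}$ into a direct sum of subspaces with $A^{(g)}A^{(h)}\subseteq A^{(gh)}$ for all $g,h\in G$. A homomorphism of algebras $\psi\colon A\to B$ between algebras graded by groups $G$ and $H$ (possibly different) is graded if for every $g\in G$ there exists $h\in H$ with $\psi(A^{(g)})\subseteq B^{(h)}$. A graded homomorphism is graded injective if its restriction to each homogeneous component $A^{(g)}$ is injective. $\mathbf{GrAlg}_F$ is the category whose objects are all gradings by arbitrary groups on (not necessarily unital) associative $F$-algebras and whose morphisms are the graded homomorphisms. $\mathbf{GrAlg}^1_F$ is the category whose objects are all group gradings on unital associative $F$-algebras and whose morphisms are the unital graded homomorphisms. *)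

(* Defs.v *)
From HB Require Import structures.
From mathcomp Require Import all_boot ssralg.
From mathcomp Require Import boolp classical_sets.

Set Implicit Arguments.
Unset Strict Implicit.
Unset Printing Implicit Defensive.

Import GRing.Theory.
Local Open Scope ring_scope.
Local Open Scope classical_set_scope.

(* The library's algType is a nonzero unital ring, so neither non-unital
   algebras nor the zero algebra are instances of it. *)
HB.mixin Record Lmodule_isAssocAlg (F : fieldType) (A : Type)
    of GRing.Lmodule F A := {
  amul : A -> A -> A;
  amulA : associative amul;
  amulDl : left_distributive amul +%R;
  amulDr : right_distributive amul +%R;
  ascaleAl : forall (k : F) (x y : A), k *: amul x y = amul (k *: x) y;
  ascaleAr : forall (k : F) (x y : A), k *: amul x y = amul x (k *: y)
}.

#[short(type="assocAlgType")]
HB.structure Definition AssocAlg (F : fieldType) :=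
  {A of GRing.Lmodule F A & Lmodule_isAssocAlg F A}.

(* 1 <> 0 is not required: the zero algebra is unital. *)
HB.mixin Record AssocAlg_isUnital (F : fieldType) (A : Type)
    of AssocAlg F A := {
  aone : A;
  amul1a : left_id aone (@amul F A);
  amula1 : right_id aone (@amul F A)
}.

#[short(type="unitalAlgType")]
HB.structure Definition UnitalAlg (F : fieldType) :=
  {A of AssocAlg F A & AssocAlg_isUnital F A}.

(* gr_span and gr_indep together say that A is the (internal) direct sum of
   the subspaces gr_comp g. *)
Record grading (F : fieldType) (G : groupType) (A : assocAlgType F) := Grading {
  gr_comp :> G -> set A;
  gr_zero : forall g, gr_comp g 0;
  gr_lin : forall g (k : F) (x y : A),
    gr_comp g x -> gr_comp g y -> gr_comp g (k *: x + y);
  gr_span : forall a : A, exists (s : seq G) (x : G -> A),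
    (forall g, gr_comp g (x g)) /\ a = \sum_(g <- s) x g;
  gr_indep : forall (s : seq G) (x : G -> A), uniq s ->
    (forall g, gr_comp g (x g)) -> \sum_(g <- s) x g = 0 ->
    forall g, g \in s -> x g = 0;
  gr_mul : forall g h (x y : A),
    gr_comp g x -> gr_comp h y -> gr_comp (g * h)%g (amul x y)
}.

Definition homogeneous (F : fieldType) (G : groupType) (A : assocAlgType F)
    (GA : grading G A) : set A :=
  \bigcup_g GA g.

Definition is_graded_hom (F : fieldType) (G H : groupType)
    (A B : assocAlgType F) (GA : grading G A) (GB : grading H B)
    (f : A -> B) : Prop :=
  [/\ linear f,
      {morph f : x y / amul x y}
    & forall g : G, exists h : H, f @` GA g `<=` GB h].

Definition graded_injective (F : fieldType) (G : groupType)
    (A : assocAlgType F) (GA : grading G A) (T : Type) (f : A -> T) : Prop :=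
  forall (g : G) (a b : A), GA g a -> GA g b -> f a = f b -> a = b.

Record category := Category {
  obj :> Type;
  mor : obj -> obj -> Type;
  idmap : forall X, mor X X;
  mcomp : forall X Y Z, mor Y Z -> mor X Y -> mor X Z;
  mcomp1m : forall X Y (f : mor X Y), mcomp (idmap Y) f = f;
  mcompm1 : forall X Y (f : mor X Y), mcomp f (idmap X) = f;
  mcompA : forall W X Y Z (f : mor Y Z) (g : mor X Y) (h : mor W X),
    mcomp f (mcomp g h) = mcomp (mcomp f g) h
}.

Definition monomorphism (C : category) (X Y : C) (f : mor X Y) : Prop :=
  forall (Z : C) (g h : mor Z X), mcomp f g = mcomp f h -> g = h.

Section GradedAlgebras.
Variable F : fieldType.

Lemma is_graded_hom_id (G : groupType) (A : assocAlgType F)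
  (GA : grading G A) : is_graded_hom GA GA id.
Proof. by split=> // g; exists g => _ [x xg <-]. Qed.

Lemma is_graded_hom_comp (G H K : groupType) (A B C : assocAlgType F)
    (GA : grading G A) (GB : grading H B) (GC : grading K C)
    (f : B -> C) (g : A -> B) :
  is_graded_hom GB GC f -> is_graded_hom GA GB g ->
  is_graded_hom GA GC (f \o g).
Proof.
move=> [linf mulf grf] [ling mulg grg]; split.
- by move=> k x y; rewrite /= ling linf.
- by move=> x y; rewrite /= mulg mulf.
move=> u; have [v gv] := grg u; have [w fw] := grf v; exists w.
by move=> _ [x xu <-]; apply: fw; exists (g x) => //; apply: gv; exists x.
Qed.

Record graded_alg := GradedAlg {
  ga_group : groupType;
  ga_alg : assocAlgType F;
  ga_grading : grading ga_group ga_alg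
}.

Record graded_hom (A B : graded_alg) := GradedHom {
  gh_fun :> ga_alg A -> ga_alg B;
  gh_graded : is_graded_hom (ga_grading A) (ga_grading B) gh_fun
}.

Lemma graded_hom_ext (A B : graded_alg) (f g : graded_hom A B) :
  gh_fun f = gh_fun g -> f = g.
Proof.
by case: f g => [f pf] [g pg] /= fg; case: _ / fg in pg *; congr GradedHom.
Qed.

Definition graded_id (A : graded_alg) : graded_hom A A :=
  GradedHom (is_graded_hom_id (ga_grading A)).

Definition graded_comp (A B C : graded_alg) (f : graded_hom B C)
    (g : graded_hom A B) : graded_hom A C :=
  GradedHom (is_graded_hom_comp (gh_graded f) (gh_graded g)).

Definition GrAlg : category.
refine (@Category graded_alg graded_hom graded_id graded_comp _ _ _);
  by move=> *; apply: graded_hom_ext.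
Defined.

Record graded_ualg := GradedUAlg {
  gu_group : groupType;
  gu_alg : unitalAlgType F;
  gu_grading : grading gu_group gu_alg
}.

Record graded_uhom (A B : graded_ualg) := GradedUHom {
  gu_fun :> gu_alg A -> gu_alg B;
  gu_graded : is_graded_hom (gu_grading A) (gu_grading B) gu_fun;
  gu_one : gu_fun aone = aone
}.

Lemma graded_uhom_ext (A B : graded_ualg) (f g : graded_uhom A B) :
  gu_fun f = gu_fun g -> f = g.
Proof.
case: f g => [f pf f1] [g pg g1] /= fg; case: _ / fg in pg g1 *.
by congr GradedUHom.
Qed.

Definition graded_uid (A : graded_ualg) : graded_uhom A A :=
  @GradedUHom A A id (is_graded_hom_id (gu_grading A)) erefl.

Lemma graded_ucomp_one (A B C : graded_ualg) (f : graded_uhom B C)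
  (g : graded_uhom A B) : (f \o g) aone = aone.
Proof. by rewrite /= !gu_one. Qed.

Definition graded_ucomp (A B C : graded_ualg) (f : graded_uhom B C)
    (g : graded_uhom A B) : graded_uhom A C :=
  GradedUHom (is_graded_hom_comp (gu_graded f) (gu_graded g))
    (graded_ucomp_one f g).

Definition GrAlg1 : category.
refine (@Category graded_ualg graded_uhom graded_uid graded_ucomp _ _ _);
  by move=> *; apply: graded_uhom_ext.
Defined.

End GradedAlgebras.

(* Main.v *)
From HB Require Import structures.
Require Import Defs.
From mathcomp Require Import all_boot ssralg poly.
From mathcomp Require Import boolp classical_sets.

(** A homogeneous element of a graded algebra is the image of the generator
    under a graded homomorphism from a free algebra on one generator, that is,
    from [F[X]] in the unital case and from [X F[X]] in the non-unital one.
    So if [f a = f b] with [a], [b] homogeneous, the two evaluation maps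
    [X |-> a] and [X |-> b] are equalized by [f], and a monomorphism [f] forces
    [a = b].  Both evaluations must be graded for one and the same grading of
    the source: when [a], [b] have degrees [g], [h], giving [X] the degree
    [(g, h)] in the product group makes this hold ([is_graded_hom_eval], with
    the first projection for [a] and the second for [b]).  In the unital case
    the evaluation of [X^0] is the unit, so one also needs the unit of a graded
    algebra to be homogeneous of trivial degree ([gr_aone]).

    Conversely, let [f] separate homogeneous elements and let [f \o u = f \o v]
    with [u], [v] graded.  Both [u] and [v] send homogeneous elements to
    homogeneous elements, so they agree on them; homogeneous elements span, so
    [u = v] ([graded_cancel]). *)

Set Implicit Arguments.
Unset Strict Implicit.
Unset Printing Implicit Defensive.

Import GRing.Theory.
Local Open Scope ring_scope.
Local Open Scope classical_set_scope.

(** * Products of groups *)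

Section ProductGroup.
Variables G H : groupType.
Implicit Types x y : G * H.

Definition pair_mul x y : G * H := ((x.1 * y.1)%g, (x.2 * y.2)%g).
Definition pair_inv x : G * H := ((x.1)^-1%g, (x.2)^-1%g).

Fact pair_mulA : associative pair_mul.
Proof. by move=> x y z; rewrite /pair_mul /= !mulgA. Qed.

Fact pair_mul1 : left_id (1%g, 1%g) pair_mul.
Proof. by move=> [x y]; rewrite /pair_mul /= !mul1g. Qed.

Fact pair_mulg1 : right_id (1%g, 1%g) pair_mul.
Proof. by move=> [x y]; rewrite /pair_mul /= !mulg1. Qed.

Fact pair_mulV : left_inverse (1%g, 1%g) pair_inv pair_mul.
Proof. by move=> [x y]; rewrite /pair_mul /= !mulVg. Qed.

Fact pair_mulgV : right_inverse (1%g, 1%g) pair_inv pair_mul.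
Proof. by move=> [x y]; rewrite /pair_mul /= !mulgV. Qed.

HB.instance Definition _ := isGroup.Build (G * H)%type
  pair_mulA pair_mul1 pair_mulg1 pair_mulV pair_mulgV.

End ProductGroup.

(** * Linear maps and the bilinear product *)

(** Graded homomorphisms and the partial products carry linearity as a property
    of a bare function, so it is packed here to reach the theory of linear
    maps. *)
Section LinearMap.
Variables (R : nzRingType) (U V : lmodType R) (f : U -> V).
Hypothesis linf : linear f.

Let f' := HB.pack_for {linear U -> V} f
  (GRing.isLinear.Build R U V *:%R f linf).

Lemma linear_sum_fun (I : Type) (s : seq I) (x : I -> U) :
  f (\sum_(i <- s) x i) = \sum_(i <- s) f (x i).
Proof. exact: (linear_sum f'). Qed.

Lemma linear_scale_fun k x : f (k *: x) = k *: f x.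
Proof. exact: (linearZ_LR f'). Qed.

End LinearMap.

Section Product.
Variables (F : fieldType) (A : assocAlgType F).
Implicit Types x y : A.

Lemma linear_amulr y : linear (amul^~ y : A -> A).
Proof. by move=> k u v; rewrite amulDl -ascaleAl. Qed.

Lemma linear_amull x : linear (amul x : A -> A).
Proof. by move=> k u v; rewrite amulDr -ascaleAr. Qed.

Lemma amul_suml (I : Type) (s : seq I) (x : I -> A) y :
  amul (\sum_(i <- s) x i) y = \sum_(i <- s) amul (x i) y.
Proof. exact: (linear_sum_fun (linear_amulr y)). Qed.

Lemma amul_sumr (I : Type) (s : seq I) x (y : I -> A) :
  amul x (\sum_(i <- s) y i) = \sum_(i <- s) amul x (y i).
Proof. exact: (linear_sum_fun (linear_amull x)). Qed.

End Product.

(** * Homogeneous components *)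

Section Grading.
Variables (F : fieldType) (G : groupType) (A : assocAlgType F).
Variable GA : grading G A.

Lemma gr_scale g (k : F) x : GA g x -> GA g (k *: x).
Proof. by move=> gx; rewrite -[k *: x]addr0; apply: gr_lin (gr_zero _ _). Qed.

Lemma gr_add g x y : GA g x -> GA g y -> GA g (x + y).
Proof. by move=> gx gy; rewrite -[x]scale1r; apply: gr_lin. Qed.

Lemma gr_sub g x y : GA g x -> GA g y -> GA g (x - y).
Proof. by move=> gx gy; rewrite addrC -scaleN1r; apply: gr_lin. Qed.

Lemma gr_sum g (I : Type) (s : seq I) (x : I -> A) :
  (forall i, GA g (x i)) -> GA g (\sum_(i <- s) x i).
Proof.
by move=> gx; elim/big_rec: _ => [|i y _ gy]; [apply: gr_zero|apply: gr_add].
Qed.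

(** The family given by [gr_span] is indexed by a list of degrees that may
    repeat, whereas [gr_indep] applies to lists without repetition; counting
    multiplicities merges the repeated terms.  Putting a chosen degree [g0] in
    the list lets one speak of the component of degree [g0] even when it
    vanishes. *)
Lemma gr_span_uniq (g0 : G) (a : A) : exists (s : seq G) (x : G -> A),
  [/\ uniq s, g0 \in s, forall g, GA g (x g) & a = \sum_(g <- s) x g].
Proof.
have [s [x [gx ->]]] := gr_span GA a.
exists (undup (g0 :: s)), (fun g => x g *+ count_mem g s).
split=> [||g|]; first exact: undup_uniq.
- by rewrite mem_undup mem_head.
- by rewrite -scaler_nat; apply: gr_scale.
rewrite [LHS](_ : _ = \sum_(g <- undup s) x g *+ count_mem g s); last first.
  rewrite big_undup_iterop_count; apply: eq_bigr => g _.
  by elim: (count_mem g s) => // n <-.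
rewrite /=; case: ifP => // g0s; rewrite big_cons.
by rewrite (count_memPn _) ?g0s// mulr0n add0r.
Qed.

Lemma gr_ext (T : lmodType F) (u v : A -> T) : linear u -> linear v ->
  (forall a, homogeneous GA a -> u a = v a) -> u = v.
Proof.
move=> linu linv uv; apply/funext => a.
have [s [x [gx ->]]] := gr_span GA a.
rewrite (linear_sum_fun linu) (linear_sum_fun linv).
by apply: eq_bigr => g _; apply: uv; exists g.
Qed.

End Grading.

(** Let [e] be the component of trivial degree of the unit.  For [y] of degree
    [h], comparing the components of degree [h] in [y = y * 1] gives
    [y * e = y].  Hence [e] is a right unit, and so equal to the unit. *)
Lemma gr_aone (F : fieldType) (G : groupType) (A : unitalAlgType F)
  (GA : grading G A) : GA 1%g aone.
Proof.
have [s [x [s_uniq s1 gx one_sum]]] := gr_span_uniq GA 1%g aone.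
have right_unit h y : GA h y -> amul y (x 1%g) = y.
  move=> hy.
  (* [z k] is the component of degree [k] in [y * 1 - y]. *)
  pose z k := amul y (x (h^-1 * k)%g) - (if k == h then y else 0).
  have gz k : GA k (z k).
    apply: gr_sub; last by case: eqP => [->|_] //; apply: gr_zero.
    by have := gr_mul hy (gx (h^-1 * k)%g); rewrite mulVKg.
  have hs : h \in [seq (h * g)%g | g <- s].
    by apply/mapP; exists 1%g; rewrite ?mulg1.
  have ts_uniq : uniq [seq (h * g)%g | g <- s].
    by rewrite map_inj_uniq // => i j /mulgI.
  have z0 : \sum_(k <- [seq (h * g)%g | g <- s]) z k = 0.
    rewrite sumrB big_map /=; under eq_bigr do rewrite mulKg.
    rewrite -amul_sumr -one_sum amula1 (bigD1_seq h) //= eqxx.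
    by rewrite big1 ?addr0 ?subrr // => k /negPf ->.
  have := gr_indep ts_uniq gz z0 hs.
  by rewrite /z eqxx mulVg => /eqP; rewrite subr_eq0 => /eqP.
suff <- : x 1%g = aone by apply: gx.
rewrite -[LHS]amul1a {1}one_sum amul_suml one_sum.
by apply: eq_bigr => g _; apply: right_unit (gx g).
Qed.

(** * Free algebras on one generator *)

(** The polynomial [p] stands for [p * 'X^d], so that this is the ideal
    generated by ['X^d] in [F[X]]: for [d = 0] it is the free unital algebra on
    one generator, for [d = 1] the free non-unital one. *)
Definition xpoly (F : fieldType) (d : nat) : Type := {poly F}.

Section ShiftedPolynomials.
Variables (F : fieldType) (d : nat).

HB.instance Definition _ := GRing.Lmodule.on (xpoly F d).

Definition xpoly_mul (p q : xpoly F d) : xpoly F d :=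
  (p : {poly F}) * (q : {poly F}) * 'X^d.

Fact xpoly_mulA : associative xpoly_mul.
Proof. by move=> p q r; rewrite /xpoly_mul !mulrA [_ * 'X^d * r]mulrAC. Qed.

Fact xpoly_mulDl : left_distributive xpoly_mul +%R.
Proof. by move=> p q r; rewrite /xpoly_mul !mulrDl. Qed.

Fact xpoly_mulDr : right_distributive xpoly_mul +%R.
Proof. by move=> p q r; rewrite /xpoly_mul mulrDr mulrDl. Qed.

Fact xpoly_scaleAl (k : F) (p q : xpoly F d) :
  k *: xpoly_mul p q = xpoly_mul (k *: p) q.
Proof. by rewrite /xpoly_mul !scalerAl. Qed.

Fact xpoly_scaleAr (k : F) (p q : xpoly F d) :
  k *: xpoly_mul p q = xpoly_mul p (k *: q).
Proof. by rewrite /xpoly_mul scalerAl scalerAr. Qed.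

HB.instance Definition _ := Lmodule_isAssocAlg.Build F (xpoly F d)
  xpoly_mulA xpoly_mulDl xpoly_mulDr xpoly_scaleAl xpoly_scaleAr.

End ShiftedPolynomials.

Section Unit.
Variable F : fieldType.

Fact xpoly_mul1 : left_id (1 : {poly F}) (@xpoly_mul F 0).
Proof. by move=> p; rewrite /xpoly_mul expr0 mulr1 mul1r. Qed.

Fact xpoly_mulr1 : right_id (1 : {poly F}) (@xpoly_mul F 0).
Proof. by move=> p; rewrite /xpoly_mul expr0 !mulr1. Qed.

HB.instance Definition _ :=
  AssocAlg_isUnital.Build F (xpoly F 0) xpoly_mul1 xpoly_mulr1.

End Unit.

Section WeightGrading.
Variables (F : fieldType) (d : nat) (K : groupType) (w : nat -> K).
Hypothesis wM : forall i j, w (i + j + d) = (w i * w j)%g.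

(** The monomials are homogeneous, ['X^i] (standing for ['X^(i + d)]) having
    degree [w i].  Distinct monomials may share a degree, so this is a grading
    by any group in which the generator is given a degree. *)
Definition weight_comp (k : K) : set (xpoly F d) :=
  [set p | forall i, (p : {poly F})`_i != 0 -> w i = k].

Lemma weight_comp_coef0 k (p : xpoly F d) i :
  weight_comp k p -> w i != k -> (p : {poly F})`_i = 0.
Proof. by move=> kp; apply: contra_neqP => /eqP/kp ->. Qed.

Fact weight_zero k : weight_comp k 0.
Proof. by move=> i; rewrite coef0 eqxx. Qed.

Fact weight_lin k (c : F) (p q : xpoly F d) :
  weight_comp k p -> weight_comp k q -> weight_comp k (c *: p + q).
Proof.
move=> kp kq i; apply: contraPP => /eqP wi.
rewrite coefD coefZ (weight_comp_coef0 kp wi) (weight_comp_coef0 kq wi).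
by rewrite mulr0 addr0 eqxx.
Qed.

Fact weight_span (p : xpoly F d) : exists (s : seq K) (x : K -> xpoly F d),
  (forall k, weight_comp k (x k)) /\ p = \sum_(k <- s) x k.
Proof.
pose n := size (p : {poly F}).
exists (undup [seq w i | i <- iota 0 n]).
exists (fun k => \poly_(i < n) (if w i == k then (p : {poly F})`_i else 0)).
split=> [k i|].
  rewrite coef_poly.
  by do 2![case: ifP => [|_]; last by rewrite eqxx]; move=> /eqP.
apply/polyP => i; rewrite coef_sum.
have [lt_i_n|le_n_i] := ltnP i n; last first.
  by rewrite nth_default // big1 // => k _; rewrite coef_poly ltnNge le_n_i.
rewrite (bigD1_seq (w i)) ?undup_uniq //=; last first.
  by rewrite mem_undup map_f // mem_iota.
rewrite coef_poly lt_i_n eqxx big1 ?addr0 // => k /negPf wik.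
by rewrite coef_poly eq_sym wik if_same.
Qed.

Fact weight_indep (s : seq K) (x : K -> xpoly F d) : uniq s ->
  (forall k, weight_comp k (x k)) -> \sum_(k <- s) x k = 0 ->
  forall k, k \in s -> x k = 0.
Proof.
move=> s_uniq kx x0 k ks; apply/polyP => i; rewrite coef0.
have [wi|wi] := eqVneq (w i) k; last exact: weight_comp_coef0 (kx k) wi.
have : (\sum_(k <- s) x k : {poly F})`_i = 0 by rewrite x0 coef0.
rewrite coef_sum (bigD1_seq k) //= big1 ?addr0 // => l lk.
by apply: weight_comp_coef0 (kx l) _; rewrite wi eq_sym.
Qed.

Fact weight_mul k l (p q : xpoly F d) :
  weight_comp k p -> weight_comp l q -> weight_comp (k * l)%g (amul p q).
Proof.
move=> kp lq n; apply: contraPP => /eqP wn.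
apply/negP; rewrite negbK /amul /= /xpoly_mul coefMXn.
case: ltnP => // le_d_n; rewrite coefM big1 // => -[i /= lt_i] _.
have [wi|wi] := eqVneq (w i) k; last by rewrite (weight_comp_coef0 kp wi) mul0r.
rewrite (weight_comp_coef0 lq) ?mulr0 //.
apply: contraNneq wn => wj.
by rewrite -wi -wj -wM subnKC // subnK.
Qed.

Definition weight_grading : grading K (xpoly F d) :=
  Grading weight_zero weight_lin weight_span weight_indep weight_mul.

End WeightGrading.

(** * Evaluation at a homogeneous element *)

Section Evaluation.
Variables (F : fieldType) (d : nat) (A : assocAlgType F) (e : nat -> A).

Definition eval_xpoly (p : xpoly F d) : A :=
  \sum_(i <- iota 0 (size (p : {poly F}))) (p : {poly F})`_i *: e i.

Lemma eval_xpolyE n (p : xpoly F d) : size (p : {poly F}) <= n ->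
  eval_xpoly p = \sum_(i <- iota 0 n) (p : {poly F})`_i *: e i.
Proof.
move=> le_p_n; rewrite /eval_xpoly -(subnKC le_p_n) iotaD big_cat /=.
rewrite [X in _ + X]big1_seq ?addr0 // => i.
by rewrite mem_iota => /andP[_ /andP[/(nth_default 0) -> _]]; rewrite scale0r.
Qed.

Lemma eval_xpoly_linear : linear eval_xpoly.
Proof.
move=> k p q.
pose n := maxn (size (p : {poly F})) (size (q : {poly F})).
have szp : size (p : {poly F}) <= n by rewrite leq_maxl.
have szq : size (q : {poly F}) <= n by rewrite leq_maxr.
have szpq : size (k *: p + q : {poly F}) <= n.
  apply: leq_trans (size_polyD _ _) _; rewrite geq_max szq andbT.
  exact: leq_trans (size_scale_leq _ _) szp.
rewrite !(@eval_xpolyE n) // scaler_sumr -big_split /=.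
by apply: eq_bigr => i _; rewrite coefD coefZ scalerDl scalerA.
Qed.

Lemma eval_xpolyXn i : eval_xpoly 'X^i = e i.
Proof.
rewrite /eval_xpoly size_polyXn (bigD1_seq i) ?iota_uniq ?mem_iota //=.
rewrite coefXn eqxx scale1r big1 ?addr0 // => j ji.
by rewrite coefXn (negPf ji) scale0r.
Qed.

Lemma xpoly_sumXn (p : xpoly F d) :
  p = \sum_(i <- iota 0 (size (p : {poly F})))
        (p : {poly F})`_i *: ('X^i : xpoly F d).
Proof.
rewrite -[LHS](@coefK F p) poly_def.
rewrite -(big_mkord xpredT (fun i => (p : {poly F})`_i *: 'X^i)).
by rewrite /index_iota subn0.
Qed.

Lemma eval_xpolyM : (forall i j, amul (e i) (e j) = e (i + j + d)) ->
  {morph eval_xpoly : p q / amul p q}.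
Proof.
move=> eM p q; rewrite {1}(xpoly_sumXn p) {1}(xpoly_sumXn q).
rewrite amul_suml (linear_sum_fun eval_xpoly_linear) [RHS]amul_suml.
apply: eq_bigr => i _.
rewrite amul_sumr (linear_sum_fun eval_xpoly_linear) [RHS]amul_sumr.
apply: eq_bigr => j _; rewrite -!ascaleAl -!ascaleAr.
rewrite !(linear_scale_fun eval_xpoly_linear) eM; congr (_ *: (_ *: _)).
by rewrite -eval_xpolyXn /amul /= /xpoly_mul -!exprD.
Qed.

(** The monomials in the component of degree [k] are all sent to degree [pi k].
    Letting [pi] differ from the identity is what allows two evaluations at
    elements of different degrees to be graded for one grading of the source. *)
Lemma is_graded_hom_eval (G K : groupType) (GA : grading G A) (w : nat -> K)
    (wM : forall i j, w (i + j + d) = (w i * w j)%g) (pi : K -> G) :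
  (forall i j, amul (e i) (e j) = e (i + j + d)) ->
  (forall i, GA (pi (w i)) (e i)) ->
  is_graded_hom (weight_grading F wM) GA eval_xpoly.
Proof.
move=> eM ge; split; [exact: eval_xpoly_linear | exact: eval_xpolyM |].
move=> k; exists (pi k) => _ [p kp <-]; apply: gr_sum => i.
have [->|/kp <-] := eqVneq (p : {poly F})`_i 0.
  by rewrite scale0r; apply: gr_zero.
exact: gr_scale.
Qed.

End Evaluation.

Lemma linear_eval_xpoly (F : fieldType) (d : nat) (A B : assocAlgType F)
    (f : A -> B) (e : nat -> A) (p : xpoly F d) : linear f ->
  f (eval_xpoly e p) = eval_xpoly (f \o e) p.
Proof.
move=> linf; rewrite (linear_sum_fun linf).
by apply: eq_bigr => i _; apply: (linear_scale_fun linf).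
Qed.

(** With [z = a] these are the powers [a^(i + 1)], which exist in any algebra;
    with [z] the unit they are the powers [a^i]. *)
Definition power_seq (F : fieldType) (A : assocAlgType F) (a z : A) (i : nat) :
    A :=
  iter i (amul a) z.

Section PowerSequence.
Variables (F : fieldType) (A : assocAlgType F) (a z : A).

Lemma power_seqM d :
  (forall j, amul z (power_seq a z j) = power_seq a z (j + d)) ->
  forall i j,
    amul (power_seq a z i) (power_seq a z j) = power_seq a z (i + j + d).
Proof.
move=> zM i j; elim: i => [|i IHi]; first exact: zM.
by rewrite /= -amulA IHi.
Qed.

Lemma gr_power_seq (G : groupType) (GA : grading G A) g d i :
  GA g a -> GA (g ^+ d)%g z -> GA (g ^+ (i + d))%g (power_seq a z i).
Proof.
move=> ga gz; elim: i => [|i IHi] //=.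
by rewrite expgS; apply: gr_mul.
Qed.

Lemma morph_power_seq (B : assocAlgType F) (f : A -> B) :
  {morph f : x y / amul x y} -> forall i,
  f (power_seq a z i) = power_seq (f a) (f z) i.
Proof. by move=> fM; elim=> //= i IHi; rewrite fM IHi. Qed.

End PowerSequence.

Lemma pair_weightM (G H : groupType) (g : G) (h : H) d i j :
  ((g ^+ (i + j + d + d), h ^+ (i + j + d + d)) =
   (g ^+ (i + d), h ^+ (i + d)) * (g ^+ (j + d), h ^+ (j + d)))%g.
Proof.
have -> : (i + j + d + d = (i + d) + (j + d))%N.
  by rewrite addnACA addnA.
by rewrite !expgnDr.
Qed.

(** * Monomorphisms of graded algebras *)

(** For homogeneous [c], both [u c] and [v c] are homogeneous, but possibly of
    different degrees, which is why [f] must separate homogeneous elements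
    across components. *)
Lemma graded_cancel (F : fieldType) (G K : groupType)
    (C A : assocAlgType F) (T : Type) (GC : grading K C) (GA : grading G A)
    (f : A -> T) (u v : C -> A) :
  {in homogeneous GA &, injective f} ->
  is_graded_hom GC GA u -> is_graded_hom GC GA v ->
  f \o u = f \o v -> u = v.
Proof.
move=> finj [linu _ gru] [linv _ grv] fuv; apply: (gr_ext (GA := GC)) => //.
move=> c [k _ kc]; have [g ug] := gru k; have [h vh] := grv k.
apply: finj; last exact: (congr1 (@^~ c) fuv).
- by apply/mem_set; exists g => //; apply: ug; exists c.
by apply/mem_set; exists h => //; apply: vh; exists c.
Qed.

Section Monomorphisms.
Variable F : fieldType.

Lemma GrAlg_mono_homogeneous (A B : GrAlg F) (f : mor A B) (a b : ga_alg A) :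
  monomorphism f ->
  homogeneous (ga_grading A) a -> homogeneous (ga_grading A) b ->
  f a = f b -> a = b.
Proof.
move=> fmono [g _ ga] [h _ hb] fab; have [linf fM _] := gh_graded f.
pose w i := ((g ^+ (i + 1), h ^+ (i + 1)) : _ * _)%g.
have wM i j : w (i + j + 1) = (w i * w j)%g by exact: pair_weightM.
pose Z : GrAlg F := GradedAlg (weight_grading F wM).
have pM c i j : amul (power_seq c c i) (power_seq c c j) =
    power_seq c c (i + j + 1) :> ga_alg A.
  by apply: power_seqM => k; rewrite addn1.
have ga1 i : ga_grading A (w i).1 (power_seq a a i) by apply: gr_power_seq.
have gb1 i : ga_grading A (w i).2 (power_seq b b i) by apply: gr_power_seq.
pose u : mor Z A := @GradedHom F Z A _ (is_graded_hom_eval wM (pM a) ga1).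
pose v : mor Z A := @GradedHom F Z A _ (is_graded_hom_eval wM (pM b) gb1).
suff /fmono/(congr1 (fun t : mor Z A => t ('X^0 : {poly F}))) :
    mcomp f u = mcomp f v.
  by rewrite /= !eval_xpolyXn.
apply: graded_hom_ext; apply/funext => p /=.
rewrite !linear_eval_xpoly //; apply: eq_bigr => i _ /=.
by rewrite !(morph_power_seq _ _ fM) fab.
Qed.

Lemma GrAlg1_mono_homogeneous (A B : GrAlg1 F) (f : mor A B) (a b : gu_alg A) :
  monomorphism f ->
  homogeneous (gu_grading A) a -> homogeneous (gu_grading A) b ->
  f a = f b -> a = b.
Proof.
move=> fmono [g _ ga] [h _ hb] fab; have [linf fM _] := gu_graded f.
pose w i := ((g ^+ (i + 0), h ^+ (i + 0)) : _ * _)%g.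
have wM i j : w (i + j + 0) = (w i * w j)%g by exact: pair_weightM.
pose Z : GrAlg1 F := GradedUAlg (weight_grading F wM).
have pM c i j : amul (power_seq c aone i) (power_seq c aone j) =
    power_seq c aone (i + j + 0) :> gu_alg A.
  by apply: power_seqM => k; rewrite amul1a addn0.
have ga1 i : gu_grading A (w i).1 (power_seq a aone i).
  by apply: gr_power_seq => //; apply: gr_aone.
have gb1 i : gu_grading A (w i).2 (power_seq b aone i).
  by apply: gr_power_seq => //; apply: gr_aone.
have eval1 c : eval_xpoly (power_seq c aone) (aone : xpoly F 0) =
    aone :> gu_alg A.
  exact: (eval_xpolyXn 0 (power_seq c aone) 0).
pose u : mor Z A :=
  @GradedUHom F Z A _ (is_graded_hom_eval wM (pM a) ga1) (eval1 a).
pose v : mor Z A :=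
  @GradedUHom F Z A _ (is_graded_hom_eval wM (pM b) gb1) (eval1 b).
suff /fmono/(congr1 (fun t : mor Z A => t ('X^1 : {poly F}))) :
    mcomp f u = mcomp f v.
  by rewrite /= !eval_xpolyXn /= !amula1.
apply: graded_uhom_ext; apply/funext => p /=.
rewrite !linear_eval_xpoly //; apply: eq_bigr => i _ /=.
by rewrite !(morph_power_seq _ _ fM) fab.
Qed.

End Monomorphisms.

Theorem proposition5p5 (F : fieldType) :
  (forall (A B : GrAlg F) (f : mor A B),
     monomorphism f <->
     (forall a b : ga_alg A,
        homogeneous (ga_grading A) a -> homogeneous (ga_grading A) b ->
        a <> b -> f a <> f b)) /\
  (forall (A B : GrAlg1 F) (f : mor A B),
     monomorphism f <->
     (forall a b : gu_alg A,
        homogeneous (gu_grading A) a -> homogeneous (gu_grading A) b ->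
        a <> b -> f a <> f b)) /\
  (forall (A B : GrAlg F) (f : mor A B),
     monomorphism f -> graded_injective (ga_grading A) f) /\
  (forall (A B : GrAlg1 F) (f : mor A B),
     monomorphism f -> graded_injective (gu_grading A) f).
Proof.
have separates G (A : assocAlgType F) (GA : grading G A) T (f : A -> T) :
    (forall a b : A, homogeneous GA a -> homogeneous GA b ->
       a <> b -> f a <> f b) -> {in homogeneous GA &, injective f}.
  move=> finj a b /set_mem ha /set_mem hb fab.
  by apply: contrapT => /(finj _ _ ha hb).
split; [|split; [|split]] => A B f.
- split=> [fmono a b ha hb ab fab|/separates finj Z u v fuv].
    exact/ab/(GrAlg_mono_homogeneous fmono).
  apply: graded_hom_ext.
  apply: graded_cancel finj (gh_graded u) (gh_graded v) _.
  exact: (congr1 (@gh_fun F Z B) fuv).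
- split=> [fmono a b ha hb ab fab|/separates finj Z u v fuv].
    exact/ab/(GrAlg1_mono_homogeneous fmono).
  apply: graded_uhom_ext.
  apply: graded_cancel finj (gu_graded u) (gu_graded v) _.
  exact: (congr1 (@gu_fun F Z B) fuv).
- by move=> fmono g a b ga gb; apply: GrAlg_mono_homogeneous; try exists g.
- by move=> fmono g a b ga gb; apply: GrAlg1_mono_homogeneous; try exists g.
Qed.
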